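(* There is no invertible quadratic transformation of $\mathbb R^2$ whose associated quadratic form $\omega_1$ is indefinite. That is, if $f:\mathbb R^2\to\mathbb R^2$, $(p,q)\mapsto(\tilde p,\tilde q)$, is given by $$\tilde p=a_{20}p^2+2a_{11}pq+a_{02}q^2+2a_{10}p+2a_{01}q+a_{00},$$ $$\tilde q=b_{20}p^2+2b_{11}pq+b_{02}q^2+2b_{10}p+2b_{01}q+b_{00}$$ with real coefficients, and the associated quadratic form $\omega_1$ is indefinite, then $f$ is not invertible.
   Context: A transformation of $\mathbb R^2$ is called invertible if it is a bijection $\mathbb R^2\to\mathbb R^2$. The quadratic form associated with the quadratic transformation is the form on $\mathbb R^2$ given, for $\mathbf c=(c_1,c_2)\in\mathbb R^2$, by $$\omega_1(\mathbf c)=(a_{20}b_{11}-a_{11}b_{20})\,c_1^2+(a_{20}b_{02}-a_{02}b_{20})\,c_1c_2+(a_{11}b_{02}-a_{02}b_{11})\,c_2^2 .$$ A real quadratic form is indefinite if it takes both positive and negative values. *)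

(* Defs.v *)
From mathcomp Require Import all_boot all_order all_algebra.
From mathcomp Require Import reals.

Set Implicit Arguments.
Unset Strict Implicit.
Unset Printing Implicit Defensive.

Import Order.TTheory GRing.Theory Num.Theory.
Local Open Scope ring_scope.

(* The binomial factors 2 belong to [quad_eval], not to the coefficients:
   the coefficient of p q is [2 * c11], that of p is [2 * c10], etc. *)
Record quad_coefs (R : Type) := QuadCoefs
  { c20 : R; c11 : R; c02 : R; c10 : R; c01 : R; c00 : R }.

Definition quad_eval (R : realType) (a : quad_coefs R) (x : R * R) : R :=
  c20 a * x.1 ^+ 2 + 2 * c11 a * x.1 * x.2 + c02 a * x.2 ^+ 2
  + 2 * c10 a * x.1 + 2 * c01 a * x.2 + c00 a.

Definition quad_transformation (R : realType) (a b : quad_coefs R)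
    (x : R * R) : R * R :=
  (quad_eval a x, quad_eval b x).

Definition omega1 (R : realType) (a b : quad_coefs R) (c : R * R) : R :=
  (c20 a * c11 b - c11 a * c20 b) * c.1 ^+ 2
  + (c20 a * c02 b - c02 a * c20 b) * c.1 * c.2
  + (c11 a * c02 b - c02 a * c11 b) * c.2 ^+ 2.

Definition indefinite (R : realType) (w : R * R -> R) : Prop :=
  (exists c, 0 < w c) /\ (exists c, w c < 0).

(* Main.v *)
(** The discriminant of [omega1], viewed as a binary form, coincides with that
    of the determinant [D(l, m)] of the quadratic part of [l p~ + m q~]. If
    [omega1] is indefinite, this discriminant is positive, so [D] is
    itself indefinite and some [l p~ + m q~] has a definite quadratic part. This
    combination is bounded on one side, so the transformation is not
    surjective. *)
Require Import Defs.
From mathcomp Require Import all_boot all_order all_algebra.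
From mathcomp Require Import reals.
From mathcomp Require Import ring lra.

Import Order.TTheory GRing.Theory Num.Theory.
Local Open Scope ring_scope.

Definition quad_comb {R : realType} (l m : R) (a b : quad_coefs R) :
    quad_coefs R :=
  QuadCoefs (l * c20 a + m * c20 b) (l * c11 a + m * c11 b)
    (l * c02 a + m * c02 b) (l * c10 a + m * c10 b)
    (l * c01 a + m * c01 b) (l * c00 a + m * c00 b).

Lemma quad_eval_comb (R : realType) (l m : R) (a b : quad_coefs R) x :
  quad_eval (quad_comb l m a b) x = l * quad_eval a x + m * quad_eval b x.
Proof. by rewrite /quad_eval /=; ring. Qed.

Definition quad_det {R : realType} (a : quad_coefs R) : R :=
  c20 a * c02 a - c11 a ^+ 2.

(** If the discriminant were nonpositive, completing the square would make [u] times the form and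
    [w] times the form nonnegative everywhere. As the form takes both signs, [u = w = 0], hence
    [v = 0]. *)
Lemma disc_gt0_of_indefinite (R : realFieldType) (u v w x y x' y' : R) :
  0 < u * x ^+ 2 + v * x * y + w * y ^+ 2 ->
  u * x' ^+ 2 + v * x' * y' + w * y' ^+ 2 < 0 ->
  0 < v ^+ 2 - 4 * u * w.
Proof.
move=> pos neg; rewrite ltNge; apply/negP => disc_le0.
have uform z t : 0 <= u * (u * z ^+ 2 + v * z * t + w * t ^+ 2).
  have := sqr_ge0 (2 * u * z + v * t).
  have := mulr_le0_ge0 disc_le0 (sqr_ge0 t).
  by nra.
have wform z t : 0 <= w * (u * z ^+ 2 + v * z * t + w * t ^+ 2).
  have := sqr_ge0 (2 * w * t + v * z).
  have := mulr_le0_ge0 disc_le0 (sqr_ge0 z).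
  by nra.
have u0 : u = 0.
  by apply/eqP; rewrite eq_le -(nmulr_lge0 u neg) -(pmulr_lge0 u pos) !uform.
have w0 : w = 0.
  by apply/eqP; rewrite eq_le -(nmulr_lge0 w neg) -(pmulr_lge0 w pos) !wform.
have v0 : v = 0.
  apply/eqP; rewrite -sqrf_eq0 eq_le sqr_ge0 andbT.
  by move: disc_le0; rewrite u0 mulr0 mul0r subr0.
by move: pos; rewrite u0 v0 w0 !mul0r !addr0 ltxx.
Qed.

Lemma exists_pos_of_disc_gt0 (R : realFieldType) (u v w : R) :
  0 < v ^+ 2 - 4 * u * w ->
  exists l m, 0 < u * l ^+ 2 + v * l * m + w * m ^+ 2.
Proof.
move=> disc_gt0.
have [u_lt0|u_gt0|u0] := ltrgt0P u.
- by exists 1, 0; rewrite expr1n expr0n /= !mulr0 !addr0 mulr1.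
(* Here [u < 0]; the witness solves [2 * u * l + v * m = 0], which leaves only the discriminant
   term. *)
- exists v, (- 2 * u).
  rewrite [ltRHS](_ : _ = - u * (v ^+ 2 - 4 * u * w)); last by ring.
  by rewrite mulr_gt0 // oppr_gt0.
(* With [u = 0] the form is [m * (v * l + w * m)]; for [m = v] this choice of [l] makes the second
   factor [v]. *)
- exists (1 - w), v.
  rewrite u0 mulr0 mul0r subr0 in disc_gt0.
  by rewrite u0 [ltRHS](_ : _ = v ^+ 2); last by ring.
Qed.

(* Multiplying by the leading coefficient treats positive and negative definite
   quadratic parts uniformly. *)
Lemma quad_eval_bounded (R : realType) (a : quad_coefs R) :
  0 < quad_det a -> exists k, forall x, k <= c20 a * quad_eval a x.
Proof.
case: a => A B C D E F; rewrite /quad_det /quad_eval /= => det_gt0.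
set d := A * C - B ^+ 2 in det_gt0 *.
(* The constant left after completing the square in [x], then in [y]. *)
exists (A * F - D ^+ 2 - (A * E - B * D) ^+ 2 / d) => -[x y] /=.
have d_neq0 : d != 0 by rewrite gt_eqF.
rewrite -subr_ge0 [leRHS](_ : _ =
  (A * x + B * y + D) ^+ 2 + (d * y + (A * E - B * D)) ^+ 2 / d); last first.
  by rewrite /d in d_neq0 *; field.
by rewrite addr_ge0 ?sqr_ge0 // divr_ge0 ?sqr_ge0 // ltW.
Qed.

Lemma exists_definite_comb (R : realType) (a b : quad_coefs R) :
  indefinite (omega1 a b) -> exists l m, 0 < quad_det (quad_comb l m a b).
Proof.
move=> [[c pos] [c' neg]].
have disc_gt0 := disc_gt0_of_indefinite _ _ _ _ _ _ _ _ pos neg.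
(* The three arguments are the coefficients of [quad_det (quad_comb l m a b)] as a form in [l] and
   [m]. *)
have [|l [m lm_gt0]] := exists_pos_of_disc_gt0 _ (quad_det a)
  (c20 a * c02 b + c02 a * c20 b - 2 * c11 a * c11 b) (quad_det b).
  by move: disc_gt0; congr (0 < _); rewrite /quad_det; ring.
by exists l, m; move: lm_gt0; congr (0 < _); rewrite /quad_det /=; ring.
Qed.

Theorem theorem4p1 (R : realType) (a b : quad_coefs R) :
  indefinite (omega1 a b) -> ~ bijective (quad_transformation a b).
Proof.
move=> /exists_definite_comb[l [m det_gt0]] [g _ fK].
have [k k_le] := quad_eval_bounded _ _ det_gt0.
set A := c20 _ in k_le.
have A_neq0 : A != 0.
  apply/eqP => A0; move: det_gt0; rewrite /quad_det -/A A0 mul0r sub0r.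
  by rewrite oppr_gt0 ltNge sqr_ge0.
have lm_gt0 : 0 < l ^+ 2 + m ^+ 2.
  rewrite lt0r addr_ge0 ?sqr_ge0 // andbT paddr_eq0 ?sqr_ge0 // !sqrf_eq0.
  apply: contra_neqN A_neq0 => /andP[/eqP l0 /eqP m0].
  by rewrite /A /= l0 m0 !mul0r addr0.
have n_neq0 : l ^+ 2 + m ^+ 2 != 0 by rewrite gt_eqF.
(* At a preimage of [(s * l, s * m)] the combination equals [s * (l ^+ 2 + m ^+ 2)]; [s] makes [A]
   times this [k - 1], below the bound [k]. *)
pose s := (k - 1) / (A * (l ^+ 2 + m ^+ 2)).
have [fa fb] := fK (s * l, s * m).
have := k_le (g (s * l, s * m)).
rewrite quad_eval_comb fa fb [leRHS](_ : _ = k - 1); first by lra.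
by rewrite /s; field; rewrite A_neq0 n_neq0.
Qed.
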